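(* Let $(\sigma_n)_{n\ge 1}$ be a sequence of positive real numbers, and consider the time-dependent Pólya urn with reinforcement sequence $(\sigma_n)$, with $T_0$ initial white balls and $\tau_0$ initial balls in total, where $\tau_n=\tau_0+\sum_{i=1}^n\sigma_i$. Let $\mathcal{M}$ and $\mathcal{D}$ be the monopoly and domination events of this urn. Suppose $$\sum_{n=1}^{\infty}\frac{1}{\tau_n}=\infty.$$ Then $\mathbb{P}(\mathcal{M})=0$. Suppose that additionally the following two conditions are satisfied: (1) $\dfrac{\sigma_n}{\tau_n}\asymp\dfrac1n$ as $n\to\infty$; (2) there exist a function $g:\mathbb{N}\to\mathbb{N}$ satisfying $g(n)\to\infty$ as $n\to\infty$ and constants $\alpha,\beta>0$ such that $$\alpha<\frac{\sigma_i}{\sigma_n}<\beta$$ for all $n\in\mathbb{N}$ and all integers $i$ with $n\le i\le n g(n)$. Then $\mathbb{P}(\mathcal{D})=0$.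
   Context: $\mathbb{N}=\{1,2,\dots\}$. For two positive sequences $(a_n)$ and $(b_n)$, $a_n\asymp b_n$ as $n\to\infty$ means that the sequence $(a_n/b_n)$ is bounded away from zero and infinity. Time-dependent Pólya urn: let $(\sigma_n)_{n\ge1}$ be a deterministic sequence of positive real numbers (not necessarily integers), let $\tau_0$ (initial total number of balls) and $T_0$ (initial number of white balls) be deterministic integers with $1\le T_0\le \tau_0-1$ (at least one white and one black ball initially), and set $\tau_n=\tau_0+\sum_{i=1}^n\sigma_i$ for $n\ge 0$. The random processes $(I_n)_{n\ge1}$, $(T_n)_{n\ge 0}$, $(\Theta_n)_{n\ge 0}$ are defined recursively on a probability space by $\Theta_n=T_n/\tau_n$ and $T_{n+1}=T_n+\sigma_{n+1}I_{n+1}$, where, conditionally on $\mathcal{F}_n=\sigma(I_1,\dots,I_n)$ (the generated $\sigma$-algebra), $I_{n+1}$ is a Bernoulli random variable with parameter $\Theta_n$, i.e. $I_{n+1}\in\{0,1\}$ and $\mathbb{P}(I_{n+1}=1\mid\mathcal{F}_n)=\Theta_n$. The process $(\Theta_n)$ is a bounded martingale and hence converges almost surely to a random variable denoted $\Theta$. Domination event: $\mathcal{D}=\{\Theta=0\}\cup\{\Theta=1\}$. Monopoly event: $\mathcal{M}=\{I_n=0 \text{ for all sufficiently large } n\}\cup\{I_n=1\text{ for all sufficiently large } n\}$. *)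

(* Defs.v *)
From mathcomp Require Export all_boot all_order all_algebra.
From mathcomp Require Export all_classical all_reals all_analysis.
Export Order.TTheory GRing.Theory Num.Theory.
Export numFieldNormedType.Exports.

Set Implicit Arguments.
Unset Strict Implicit.
Unset Printing Implicit Defensive.

Local Open Scope classical_set_scope.
Local Open Scope ring_scope.

(* Sequences indexed by the positive integers are functions on nat whose value
   at 0 is never used. *)

Definition asymp (R : realType) (a b : nat -> R) : Prop :=
  exists c C : R, [/\ 0 < c, 0 < C &
    forall n, (0 < n)%N -> c <= a n / b n <= C].

(* f is a version of the conditional probability P(E | F), for a
   sub-sigma-algebra F given as the set of its members. *)
Definition cond_prob_version d (Om : measurableType d) (R : realType)
    (P : probability Om R) (F : set (set Om)) (E : set Om) (f : Om -> R) : Prop :=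
  [/\ forall B : set R, measurable B -> F (f @^-1` B),
      P.-integrable setT (EFin \o f) &
      forall A, F A -> (\int[P]_(w in A) (f w)%:E = P (E `&` A))%E].

Section urn.
Context {d} {Om : measurableType d} {R : realType}.
Variables (sigma : nat -> R) (tau0 T0 : nat) (I : nat -> Om -> bool).

Definition tau (n : nat) : R := tau0%:R + \sum_(1 <= i < n.+1) sigma i.

Fixpoint white (n : nat) (w : Om) : R :=
  match n with
  | 0 => T0%:R
  | m.+1 => white m w + sigma m.+1 * (I m.+1 w)%:R
  end.

Definition white_prop (n : nat) (w : Om) : R := white n w / tau n.

Definition history (n : nat) : set (set Om) :=
  <<s \bigcup_(i in [set i | (1 <= i <= n)%N])
        preimage_set_system setT (I i) measurable >>.

(* The initial composition is subject to (1 <= T0 <= tau0 - 1) in natural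
   numbers: tau0 = 0 is excluded, as the truncated difference is then 0. *)
Definition is_polya_urn (P : probability Om R) : Prop :=
  [/\ forall n, (0 < n)%N -> 0 < sigma n,
      (1 <= T0 <= tau0 - 1)%N,
      forall n, (0 < n)%N -> measurable_fun setT (I n) &
      forall n, cond_prob_version P (history n) [set w | I n.+1 w = true]
                  (white_prop n)].

Definition monopoly : set Om :=
  [set w | \forall n \near \oo, I n w = false] `|`
  [set w | \forall n \near \oo, I n w = true].

Definition is_limit_prop (P : probability Om R) (Theta : Om -> R) : Prop :=
  {ae P, forall w, white_prop n w @[n --> \oo] --> Theta w}.

End urn.

Definition domination {Om : Type} {R : realType} (Theta : Om -> R) : set Om :=
  [set w | Theta w = 0] `|` [set w | Theta w = 1].

(* Main.v *)
(** A finite history of draws fixes the composition of the urn, so the event that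
    one colour dies out has, conditionally on each history, a probability that is
    harmonic on the binary tree of histories.  Since the number of balls of each
    colour is at least 1 and the sum of the [1 / tau n] diverges, each colour is
    drawn infinitely often: there is no monopoly, and it is enough to bound this
    conditional probability just after a draw of the colour.  After such a draw at
    time [n], as long as the time stays below [n * g n], the share of the colour
    at time [k] is at least a constant times [1 / k]; the sum of these is of order
    [ln (g n)], so with high probability the colour is drawn [K] times in the
    window.  Its share is then of order at least [K / k], and Chebyshev's
    inequality for the martingale of shares bounds the probability of later
    extinction by a constant times [1 / K]. *)
Require Import Defs.
From mathcomp Require Import ring lra zify.

Set Implicit Arguments.
Unset Strict Implicit.
Unset Printing Implicit Defensive.

Local Open Scope classical_set_scope.
Local Open Scope ring_scope.

(** * Composition of the urn along a finite history *)

Section tree.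
Variables (R : realType) (sigma : nat -> R) (tau0 T0 : nat).
Local Notation tau := (tau sigma tau0).

Definition balls0 (c : bool) : nat := if c then T0 else (tau0 - T0)%N.

(* A history lists the drawn colours with the most recent draw first. *)
Fixpoint balls (c : bool) (s : seq bool) : R :=
  if s is b :: s' then balls c s' + sigma (size s) * (b == c)%:R
  else (balls0 c)%:R.

Definition share (c : bool) (s : seq bool) : R := balls c s / tau (size s).

Hypothesis sigma_gt0 : forall n, (0 < n)%N -> 0 < sigma n.
Hypothesis T0_bounds : (1 <= T0 <= tau0 - 1)%N.

Lemma tauS n : tau n.+1 = tau n + sigma n.+1.
Proof. by rewrite /Defs.tau big_nat_recr //= addrA. Qed.

Lemma tau_ge1 n : 1 <= tau n.
Proof.
elim: n => [|n IH]; last by rewrite tauS; have := sigma_gt0 (ltn0Sn n); lra.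
by rewrite /Defs.tau big_geq // addr0 ler1n; lia.
Qed.

Lemma tau_gt0 n : 0 < tau n.
Proof. exact: lt_le_trans (tau_ge1 n). Qed.

Lemma balls_le_cons c b s : balls c s <= balls c (b :: s).
Proof.
by rewrite /= lerDl mulr_ge0 // ltW // sigma_gt0.
Qed.

Lemma balls_ge1 c s : 1 <= balls c s.
Proof.
elim: s => [|b s IH]; last exact: le_trans (balls_le_cons c b s).
by rewrite /= ler1n /balls0; case: c; lia.
Qed.

Lemma ballsC c s : balls c s + balls (~~ c) s = tau (size s).
Proof.
elim: s => [|b s IH].
  rewrite /Defs.tau big_geq // addr0 /= -natrD; congr _%:R.
  by rewrite /balls0; case: c => /=; lia.
rewrite /= tauS -IH (_ : (b == ~~ c) = ~~ (b == c)); last by case: (b) (c) => -[].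
by case: (b == c) => /=; ring.
Qed.

Lemma shareC c s : share (~~ c) s = 1 - share c s.
Proof.
rewrite /share -[1](@divff _ (tau (size s))) ?gt_eqF ?tau_gt0 //.
by rewrite -mulrBl -(ballsC c) addrAC subrr add0r.
Qed.

Lemma share_ge c s : (tau (size s))^-1 <= share c s.
Proof. by rewrite ler_peMl ?balls_ge1 // invr_ge0 ltW ?tau_gt0. Qed.

Lemma share_gt0 c s : 0 < share c s.
Proof. by apply: lt_le_trans (share_ge c s); rewrite invr_gt0 tau_gt0. Qed.

Lemma share_lt1 c s : share c s < 1.
Proof. by have := share_gt0 (~~ c) s; rewrite shareC subr_gt0. Qed.

Lemma share_cons c b s :
  share c (b :: s) =
  share c s + sigma (size s).+1 / tau (size s).+1 * ((b == c)%:R - share c s).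
Proof.
have t0 : tau (size s) != 0 by rewrite gt_eqF ?tau_gt0.
have := tau_gt0 (size s).+1; rewrite /share /= tauS => /lt0r_neq0 t1.
by field; rewrite t0 t1.
Qed.

(* [p s] and [f s] stand for the probability of the history [s] and of its
   intersection with a given event. *)
Variables (p f : seq bool -> R).
Hypothesis p_ge0 : forall s, 0 <= p s.
Hypothesis p_cons : forall c s, p (c :: s) = share c s * p s.
Hypothesis f_split : forall c s, f s = f (c :: s) + f (~~ c :: s).
Hypothesis f_le : forall s, f s <= p s.

(** * Harmonic bounds and the wait for a colour *)

Lemma split_le c s B0 B1 :
  f (c :: s) <= B1 * p (c :: s) -> f (~~ c :: s) <= B0 * p (~~ c :: s) ->
  f s <= (share c s * B1 + (1 - share c s) * B0) * p s.
Proof.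
rewrite !p_cons shareC (f_split c s) => h1 h0.
apply: le_trans (lerD h1 h0) _.
by rewrite le_eqVlt; apply/orP; left; apply/eqP; ring.
Qed.

(** Either [c] is drawn within [k] steps, and [eps] applies after its first draw, or it is avoided
    throughout; the latter has conditional probability at most the product of the [1 - 1 / tau i],
    which the exponential bounds. *)
Lemma first_draw_bound c eps N k s :
  (forall s, (N <= size s)%N -> f (c :: s) <= eps * p (c :: s)) ->
  (N <= size s)%N ->
  0 <= eps ->
  f s <= (eps + expR (- \sum_(size s <= i < size s + k) (tau i)^-1)) * p s.
Proof.
move=> hc + eps0; elim: k s => [|k IH] s Ns.
  rewrite addn0 big_geq // oppr0 expR0 (le_trans (f_le s)) //.
  by rewrite ler_peMl // lerDr.
have h0 := IH (~~ c :: s) (leqW Ns); rewrite /= in h0.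
apply: le_trans (split_le (hc _ Ns) h0) _.
rewrite addnS -addSn [X in _ <= (_ + expR (- X)) * _]big_ltn ?leq_addr // opprD expRD.
set X := expR (- \sum_(_ <= _ < _) _).
have X0 : 0 < X by exact: expR_gt0.
apply: ler_wpM2r => //.
have e1 := expR_ge1Dx (- (tau (size s))^-1).
have th := share_ge c s.
have -> : share c s * eps + (1 - share c s) * (eps + X) = eps + (1 - share c s) * X by ring.
rewrite lerD2l; apply: ler_wpM2r; first exact: ltW.
by apply: le_trans e1; lra.
Qed.

Hypothesis sum_inv_tau : (\sum_(1 <= n <oo) ((tau n)^-1)%:E = +oo)%E.

Lemma sum_inv_tau_unbounded (B : R) N : (0 < N)%N ->
  exists k, B <= \sum_(N <= i < N + k) (tau i)^-1.
Proof.
move=> N0; apply: contrapT => /forallNP hB.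
pose C := \sum_(1 <= i < N) (tau i)^-1 + B.
suff : (\sum_(1 <= n <oo) ((tau n)^-1)%:E <= C%:E)%E.
  by rewrite sum_inv_tau leNgt ltry.
apply: lime_le.
  by apply: is_cvg_ereal_nneg_natsum => n _; rewrite lee_fin invr_ge0 ltW ?tau_gt0.
near=> n.
have Nn : (N <= n)%N by near: n; exists N.
rewrite sumEFin lee_fin (big_cat_nat (n := N)) //= lerD2l.
have /negP := hB (n - N)%N; rewrite subnKC // -ltNge => /ltW.
exact.
Unshelve. all: by end_near.
Qed.

(** Both [f] and [p] are sums over the two children, so the bound passes level by level to the
    root. *)
Lemma harmonic_le_root eps N :
  (forall s, (N <= size s)%N -> f s <= eps * p s) -> f [::] <= eps * p [::].
Proof.
move=> hN.
suff H k s : (N - size s <= k)%N -> f s <= eps * p s by apply: (H N); rewrite leq_subr.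
elim: k s => [|k IH] s sk; first by apply: hN; lia.
have := @split_le true s eps eps.
have -> : share true s * eps + (1 - share true s) * eps = eps by ring.
by apply; apply: IH => /=; lia.
Qed.

Lemma first_draw_le c eps N :
  (forall s, (N <= size s)%N -> f (c :: s) <= eps * p (c :: s)) -> 0 <= eps ->
  f [::] <= eps * p [::].
Proof.
move=> hc eps0; apply: (@harmonic_le_root _ N.+1) => s Ns.
have Ns' : (N <= size s)%N by exact: ltnW.
apply/ler_addgt0Pr => e e0.
(* This [k] makes the sum [S] at least [p s / e], so that [p s <= e * expR S] follows from
   [1 + S <= expR S]. *)
have [k hk] := @sum_inv_tau_unbounded ((p s) / e) (size s) (leq_trans (ltn0Sn N) Ns).
apply: le_trans (@first_draw_bound c eps N k s hc Ns' eps0) _.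
rewrite mulrDl lerD2l expRN.
set S := \sum_(_ <= _ < _) _ in hk *.
have e1 := expR_ge1Dx S.
rewrite mulrC ler_pdivrMr ?expR_gt0 //.
by rewrite mulrC -ler_pdivrMr //; apply: le_trans hk _; apply: le_trans e1; lra.
Qed.

(** * Many draws of a colour within a window *)

Variables (cl al be : R) (g : nat -> nat) (K0 : R).
Hypotheses (cl_gt0 : 0 < cl) (al_gt0 : 0 < al) (be_gt0 : 0 < be) (K0_gt0 : 0 < K0).
Hypothesis sigma_ge : forall n, (0 < n)%N -> tau n * cl <= n%:R * sigma n.
Hypothesis g_gt0 : forall n, (0 < n)%N -> (0 < g n)%N.
Hypothesis sigma_al : forall n i, (0 < n)%N -> (n <= i <= n * g n)%N ->
  al * sigma n <= sigma i.
Hypothesis sigma_be : forall n i, (0 < n)%N -> (n <= i <= n * g n)%N ->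
  sigma i <= be * sigma n.
Variable c : bool.
(** Chebyshev's bound on extinction after the history [s]; in the application it comes from
    [pr_share_halved]. *)
Hypothesis f_small : forall s, (0 < size s)%N ->
  f s <= K0 / ((size s)%:R * share c s) * p s.

(** [expR (q * ln k)] is the power [k ^ q]. As [ln (1 + 1 / k) <= 1 / k], the factor
    [expR (- q / k)] gained in one step of the window absorbs the growth from [k ^ q] to
    [(k + 1) ^ q]. *)
Lemma expR_ln_step (q : R) k : 0 <= q -> (0 < k)%N ->
  expR (- (q / k%:R)) * expR (q * ln k.+1%:R) <= expR (q * ln k%:R).
Proof.
move=> q0 k0; rewrite -expRD ler_expR.
have kR : (0 : R) < k%:R by rewrite ltr0n.
have -> : (k.+1%:R : R) = k%:R * (1 + k%:R^-1).
  by rewrite mulrDr mulr1 mulfV ?gt_eqF // -natr1.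
have i0 : 0 < k%:R^-1 :> R by rewrite invr_gt0.
rewrite lnM ?posrE // ?addr_gt0 //.
have h : ln (1 + k%:R^-1) <= k%:R^-1 :> R.
  by apply: le_ln1Dx; apply: lt_trans i0; rewrite ltrN10.
rewrite mulrDr addrCA gerDl addrC subr_le0.
exact: ler_wpM2l.
Qed.

(* [m] steps remain in the window and [r] of the [K] draws of colour [c] are
   still missing.  Halving at each draw of [c] makes the second term a
   supermartingale which is at least 1 if the window closes with [r > 0]. *)
Lemma window_bound n eps K r m s :
  (0 < n)%N -> 0 <= eps ->
  K0 * be / (cl * (1 + K%:R * al)) <= eps ->
  (n <= size s)%N -> (size s + m = n * g n)%N ->
  sigma n <= balls c s ->
  sigma n * (1 + K%:R * al) <= balls c s + r%:R * al * sigma n ->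
  f s <= (eps + 2 ^+ r * expR (cl / (2 * be) * ln (size s)%:R)
                        / expR (cl / (2 * be) * ln (n * g n)%:R)) * p s.
Proof.
move=> n0 eps0 hK; set q := cl / (2 * be).
have q0 : 0 <= q by rewrite divr_ge0 ?mulr_ge0 // ltW.
set XL := expR (q * ln (n * g n)%:R).
have XL0 : 0 < XL by exact: expR_gt0.
have sn := sigma_gt0 n0.
(* [sigma_ge] gives [tau k <= k * sigma k / cl], and [sigma k <= be * sigma n] in the window: the
   share is at least of order [1 / k] once the colour has [sigma n] balls. *)
have share_lb s' : (n <= size s' <= n * g n)%N ->
    balls c s' * cl / (be * sigma n) <= (size s')%:R * share c s'.
  move=> hs; have s0 : (0 < size s')%N by case/andP: hs => /(leq_trans n0).
  rewrite ler_pdivrMr ?mulr_gt0 // /share.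
  have t0 := tau_gt0 (size s').
  rewrite mulrA mulrAC ler_pdivlMr //.
  have h1 := sigma_ge s0; have h2 := sigma_be n0 hs.
  have b1 := balls_ge1 c s'.
  have h3 : (size s')%:R * sigma (size s') <= (size s')%:R * (be * sigma n).
    by rewrite ler_wpM2l.
  have -> : balls c s' * cl * tau (size s') = balls c s' * (tau (size s') * cl) by ring.
  have -> : (size s')%:R * balls c s' * (be * sigma n) =
      balls c s' * ((size s')%:R * (be * sigma n)) by ring.
  by rewrite ler_wpM2l ?(le_trans h1) //; lra.
elim: r m s => [|r IHr] m s ns sm sb hb.
  (* No draw is missing: the colour has at least [sigma n * (1 + K * al)] balls, and [f_small]
     yields [eps] through [hK]. *)
  rewrite !mul0r addr0 in hb.
  have s0 : (0 < size s)%N := leq_trans n0 ns.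
  apply: le_trans (f_small s0) _; apply: ler_wpM2r => //.
  apply: (@le_trans _ _ eps); last first.
    by rewrite lerDl mulr_ge0 // ?mulr_ge0 ?exprn_ge0 ?expR_ge0 // invr_ge0 ltW.
  apply: le_trans hK.
  have ka : 0 < 1 + K%:R * al by rewrite ltr_wpDr // mulr_ge0 // ltW.
  have h : cl * (1 + K%:R * al) / be <= (size s)%:R * share c s.
    apply: le_trans (share_lb s _); last by rewrite ns -sm leq_addr.
    rewrite ler_pdivlMr ?mulr_gt0 // mulrA divfK ?gt_eqF //.
    by rewrite -mulrA [balls c s * cl]mulrC ler_pM2l // mulrC.
  rewrite -mulrA ler_pM2l // -invf_div lef_pV2 // posrE.
    by rewrite mulr_gt0 ?share_gt0 ?ltr0n.
  by rewrite divr_gt0 ?mulr_gt0.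
elim: m s ns sm sb hb => [|m IHm] s ns sm sb hb.
  (* The window closes with draws missing: the second term is [2 ^+ r.+1 >= 1], and [f <= p]
     suffices. *)
  rewrite addn0 in sm; rewrite sm -/XL -mulrA divff ?gt_eqF // mulr1.
  apply: le_trans (f_le s) _; rewrite ler_peMl //.
  have : 1 <= 2 ^+ r.+1 :> R by rewrite exprn_ege1 // ler1n.
  lra.
have s0 : (0 < size s)%N := leq_trans n0 ns.
have sk : (size s < n * g n)%N by rewrite -sm -addSnnS leq_addr.
have al_s : al * sigma n <= sigma (size s).+1.
  by apply: sigma_al => //; rewrite sk leqW.
have ns1 : (n <= (size s).+1)%N by exact: leqW.
have sm1 : ((size s).+1 + m = n * g n)%N by rewrite addSnnS.
have h1 := IHr m (c :: s) ns1 sm1 (le_trans sb (balls_le_cons c c s)).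
have {}h1 := h1 _.
have h0 := IHm (~~ c :: s) ns1 sm1 (le_trans sb (balls_le_cons c (~~ c) s)).
have {}h0 := h0 (le_trans hb _).
apply: le_trans (split_le (h1 _) (h0 _)) _.
- by rewrite /= eqxx mulr1; move: hb; rewrite -natr1; lra.
- by rewrite lerD2r balls_le_cons.
apply: ler_wpM2r => //=.
set th := share c s; set Y := expR (q * ln (size s).+1%:R).
rewrite exprS; set G := 2 ^+ r.
have G0 : 0 < G by rewrite exprn_gt0.
(* A draw of [c], of probability [th], halves the second term, whence the mean factor [1 - th / 2].
   It is at most [expR (- q / size s)] because [q] is half of [cl / be <= size s * th]. *)
have -> : th * (eps + G * Y / XL) + (1 - th) * (eps + 2 * G * Y / XL) =
  eps + 2 * G * ((1 - th / 2) * Y) / XL by field; rewrite gt_eqF.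
rewrite lerD2l ler_pM2r ?invr_gt0 // ler_pM2l ?mulr_gt0 //.
apply: le_trans (expR_ln_step q0 s0); rewrite ler_wpM2r ?expR_ge0 //.
apply: le_trans (expR_ge1Dx _); rewrite lerD2l lerN2.
have h := share_lb s; rewrite ns /= in h.
have {}h : balls c s * cl / (be * sigma n) <= (size s)%:R * th by apply: h; exact: ltnW.
have h3 : cl / be <= balls c s * cl / (be * sigma n).
  rewrite ler_pdivlMr ?mulr_gt0 // mulrA divfK ?gt_eqF // mulrC.
  by rewrite ler_pM2r.
rewrite ler_pdivrMr ?ltr0n // /q invfM mulrCA.
have := le_trans h3 h.
by rewrite [X in _ -> _ <= X]mulrC; lra.
Qed.

Hypothesis g_infty : g n @[n --> \oo] --> \oo.

Lemma harmonic_le0 : f [::] <= 0.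
Proof.
apply/ler_addgt0Pr => e e0; rewrite add0r.
have p0 := p_ge0 [::].
pose eps := e / (p [::] + 1).
have eps0 : 0 < eps by rewrite divr_gt0 // ltr_wpDl.
suff H : f [::] <= eps * p [::].
  apply: le_trans H _; rewrite /eps -mulrA -[X in _ <= X]mulr1 ler_pM2l // mulrC.
  by rewrite ler_pdivrMr ?ltr_wpDl // mul1r lerDl.
clearbody eps.
pose q := cl / (2 * be).
have q0 : 0 < q by rewrite divr_gt0 ?mulr_gt0.
(* [K] makes the bound on extinction after [K] draws at most half of [eps]. *)
pose K := (Num.bound (2 * (K0 * be / (cl * al)) / eps)).
have hK : K0 * be / (cl * (1 + K%:R * al)) <= eps / 2.
  have ka : 0 < 1 + K%:R * al by rewrite ltr_wpDr // mulr_ge0 // ltW.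
  have : 2 * (K0 * be / (cl * al)) / eps < K%:R.
    have A0 : 0 < K0 * be / (cl * al) by rewrite divr_gt0 ?mulr_gt0.
    by apply: archi_boundP; rewrite ltW // divr_gt0 // mulr_gt0.
  rewrite ltr_pdivrMr // ler_pdivrMr ?mulr_gt0 // => h.
  have : 2 * (K0 * be / (cl * al)) * (cl * al) < K%:R * eps * (cl * al).
    by rewrite ltr_pM2r ?mulr_gt0.
  have -> : 2 * (K0 * be / (cl * al)) * (cl * al) = 2 * (K0 * be).
    by field; rewrite !gt_eqF.
  have h2 : 0 < eps * cl by rewrite mulr_gt0.
  lra.
(* At the start of the window the powers combine to [2 ^+ K * (n / (n * g n)) ^ q], that is
   [2 ^+ K / (g n) ^ q]. *)
have [N hN] : exists N, forall n, (N <= n)%N -> 2 ^+ K / expR (q * ln (g n)%:R) <= eps / 2.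
  pose B := Num.bound (expR (2 ^+ K / (eps / 2) / q)).
  have [N _ hN] := g_infty (nbhs_infty_ge B).
  exists N => n Nn; have {hN} hN : (B <= g n)%N := hN n Nn.
  have hB : expR (2 ^+ K / (eps / 2) / q) <= (g n)%:R.
    apply: le_trans (_ : B%:R <= _); last by rewrite ler_nat.
    by apply: ltW; apply: archi_boundP; exact: expR_ge0.
  have gn0 : 0 < (g n)%:R :> R := lt_le_trans (expR_gt0 _) hB.
  rewrite ler_pdivrMr ?expR_gt0 //.
  move: hB; rewrite -ler_ln ?posrE ?expR_gt0 // expRK.
  rewrite ler_pdivrMr // ler_pdivrMr ?divr_gt0 // => hB.
  apply: le_trans hB _; rewrite [X in _ <= X]mulrC ler_pM2r ?divr_gt0 //.
  by rewrite mulrC; apply: le_trans (expR_ge1Dx _); rewrite lerDr.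
apply: (@first_draw_le c _ N) => [s Ns|]; last exact: ltW.
set n := (size s).+1.
have n0 : (0 < n)%N by [].
have gn := g_gt0 n0.
(* The draw of [c] at time [n] has just added [sigma n] balls, so both conditions on [balls] hold
   with all [K] draws still missing. *)
have := @window_bound n (eps / 2) K K (n * g n - n) (c :: s) n0 _ hK (leqnn _).
rewrite /= -/n eqxx mulr1 subnKC ?leq_pmulr // => /(_ _ erefl) h.
apply: le_trans (h _ _ _) _.
- by rewrite divr_ge0 // ltW.
- by rewrite lerDr; have := balls_ge1 c s; lra.
- by have := balls_ge1 c s; rewrite -/n; lra.
apply: ler_wpM2r => //.
rewrite [X in _ <= X](splitr eps) lerD2l -/q.
rewrite natrM lnM ?posrE ?ltr0n // mulrDr expRD invfM.
rewrite -/n -mulrA mulVKf ?gt_eqF ?expR_gt0 //.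
exact: hN (leqW Ns).
Qed.
End tree.

(** Telescoping, as [1 / (m + 1) ^ 2 <= 1 / m - 1 / (m + 1)]. *)
Lemma sum_inv_sqr_le (R : realType) n k : (0 < n)%N ->
  \sum_(n <= i < n + k) (i.+1%:R ^-1) ^+ 2 <= n%:R^-1 :> R.
Proof.
move=> n0.
suff : \sum_(n <= i < n + k) (i.+1%:R ^-1) ^+ 2 <= n%:R^-1 - (n + k)%:R^-1 :> R.
  by move=> h; apply: le_trans h _; rewrite gerBl invr_ge0.
elim: k => [|k IH]; first by rewrite addn0 big_geq // subrr.
rewrite addnS big_nat_recr ?leq_addr //=; apply: le_trans (lerD IH (lexx _)) _.
have h (m : R) : 0 < m -> (m + 1)^-1 ^+ 2 <= m^-1 - (m + 1)^-1.
  move=> m0; have m1 : 0 < m + 1 by rewrite addr_gt0.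
  have -> : m^-1 - (m + 1)^-1 = m^-1 * (m + 1)^-1.
    by field; rewrite !gt_eqF.
  by rewrite expr2 ler_pM2r ?invr_gt0 // lef_pV2 ?posrE // lerDl.
have := h (n + k)%:R; rewrite ltr0n addn_gt0 n0 -natr1 => /(_ isT); lra.
Qed.

(** * The law of the urn on cylinder events *)

Section urn.
Variables (R : realType) (d : measure_display) (Om : measurableType d).
Variables (P : probability Om R) (sigma : nat -> R) (tau0 T0 : nat).
Variable I : nat -> Om -> bool.
Hypothesis urn : is_polya_urn sigma tau0 T0 I P.
Local Notation tau := (tau sigma tau0).
Local Notation share := (share sigma tau0 T0).

Fixpoint draws (n : nat) (w : Om) : seq bool :=
  if n is m.+1 then I n w :: draws m w else [::].

Definition cyl (s : seq bool) : set Om := [set w | draws (size s) w = s].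

Definition pr (A : set Om) : R := fine (P A).

Lemma size_draws n w : size (draws n w) = n.
Proof. by elim: n => //= n ->. Qed.

Lemma white_draws n w : white sigma T0 I n w = balls sigma tau0 T0 true (draws n w).
Proof. by elim: n => //= n ->; rewrite size_draws eqb_id. Qed.

Lemma white_prop_draws n w : white_prop sigma tau0 T0 I n w = share true (draws n w).
Proof. by rewrite /white_prop /share white_draws size_draws. Qed.

Lemma cyl_nil : cyl [::] = setT.
Proof. by apply/seteqP. Qed.

Lemma cyl_cons b s : cyl (b :: s) = cyl s `&` [set w | I (size s).+1 w = b].
Proof.
by apply/seteqP; split=> w; rewrite /cyl /=; [case=> -> ->|case=> -> ->].
Qed.

(** The identity for conditional probabilities in [is_polya_urn] holds on members of [history];
    [pr_cyl_cons] applies it to cylinders. *)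
Lemma history_cyl s : history I (size s) (cyl s).
Proof.
elim: s => [|b s IH].
  rewrite cyl_nil; exact: (@measurableT _ (g_sigma_algebraType _)).
rewrite cyl_cons; apply: (@measurableI _ (g_sigma_algebraType _)).
  apply: sub_sigma_algebra2 IH => A [i /= hi hA].
  by exists i => //=; lia.
apply: sub_sigma_algebra; exists (size s).+1 => /=; first by rewrite leqnn.
exists [set b] => //.
by rewrite setTI.
Qed.

Lemma measurable_draw n b : measurable [set w | I n.+1 w = b].
Proof.
have [_ _ mI _] := urn.
have := mI n.+1 isT measurableT [set b].
by rewrite setTI; apply.
Qed.

(** [Q] may be arbitrary because only finitely many histories have length [n]. *)
Lemma measurable_draws n (Q : seq bool -> Prop) : measurable [set w | Q (draws n w)].
Proof.
elim: n Q => [|n IH] Q /=.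
  have [q|q] := pselect (Q [::]).
    by rewrite (_ : [set _ | _] = setT) //; apply/seteqP; split.
  by rewrite (_ : [set _ | _] = set0) //; apply/seteqP; split.
rewrite (_ : [set _ | _] =
    ([set w | I n.+1 w = true] `&` [set w | Q (true :: draws n w)]) `|`
    ([set w | I n.+1 w = false] `&` [set w | Q (false :: draws n w)])).
  apply: measurableU; apply: measurableI; try exact: measurable_draw.
    exact: (IH (fun s => Q (true :: s))).
  exact: (IH (fun s => Q (false :: s))).
apply/seteqP; split=> w /=; case: (I n.+1 w).
- by left.
- by right.
- by case=> -[].
- by case=> -[].
Qed.

Lemma measurable_cyl s : measurable (cyl s).
Proof. exact: (@measurable_draws _ (fun t => t = s)). Qed.

Lemma EFin_pr A : measurable A -> (pr A)%:E = P A.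
Proof. by move=> mA; rewrite fineK ?fin_num_measure. Qed.

Lemma pr_ge0 A : 0 <= pr A.
Proof. exact: fine_ge0. Qed.

Lemma le_pr A B : measurable A -> measurable B -> A `<=` B -> pr A <= pr B.
Proof.
by move=> mA mB AB; rewrite -lee_fin !EFin_pr // le_measure ?inE.
Qed.

Lemma pr_cyl_split E c s : measurable E ->
  pr (cyl s `&` E) = pr (cyl (c :: s) `&` E) + pr (cyl (~~ c :: s) `&` E).
Proof.
move=> mE; apply: EFin_inj; rewrite EFinD.
have mC t : measurable (cyl t `&` E).
  by apply: measurableI => //; exact: measurable_cyl.
rewrite !EFin_pr // -measureU //.
  congr (P _); apply/seteqP; split=> w; rewrite !cyl_cons /=.
    by case: (I _ w) (c) => -[]; tauto.
  tauto.
apply/seteqP; split=> // w; rewrite !cyl_cons /= => -[[[_ ->] _] [[_ h] _]].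
by case: (c) h.
Qed.

(** The white share is constant on [cyl s], so integrating the conditional probability there gives a
    product; the black case follows by complement. *)
Lemma pr_cyl_cons c s : pr (cyl (c :: s)) = share c s * pr (cyl s).
Proof.
have [s0 Tb _ /(_ (size s)) [_ _ hP]] := urn.
have ht : pr (cyl (true :: s)) = share true s * pr (cyl s).
  have := hP _ (@history_cyl s); rewrite setIC -cyl_cons => h.
  apply: EFin_inj; rewrite EFinM !EFin_pr; try exact: measurable_cyl.
  rewrite -h -integral_cst; last exact: measurable_cyl.
  apply: eq_integral => w; rewrite inE /cyl /= => hw.
  by rewrite white_prop_draws hw.
case: c => //.
have := @pr_cyl_split setT true s measurableT; rewrite !setIT /= ht.
rewrite -[false]/(~~ true) shareC //; move: (pr _) (share _ _) (pr _) => a b e; lra.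
Qed.

(* Chebyshev's inequality around an arbitrary centre [x]: with the centre free,
   the bound can be proved by induction on the time elapsed. *)
Lemma pr_share_small c k s x y : y < x ->
  pr (cyl s `&` [set w | share c (draws (size s + k) w) <= y]) <=
  ((share c s - x) ^+ 2 +
   (\sum_(size s <= i < size s + k) (sigma i.+1 / tau i.+1) ^+ 2) * share c s)
    / (x - y) ^+ 2 * pr (cyl s).
Proof.
have [s0 Tb _ _] := urn.
move=> yx; have xy : 0 < (x - y) ^+ 2 by rewrite exprn_gt0 // subr_gt0.
elim: k s => [|k IH] s.
  rewrite addn0 big_geq // mul0r addr0.
  have [sy|ys] := leP (share c s) y.
    apply: (@le_trans _ _ (pr (cyl s))).
      apply: le_pr; last by move=> w [].
        by apply: measurableI; [exact: measurable_cyl|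
          exact: (@measurable_draws _ (fun t => share c t <= y))].
      exact: measurable_cyl.
    rewrite ler_peMl ?pr_ge0 // ler_pdivlMr // mul1r.
    by rewrite -(sqrrN (share c s - x)) opprB ler_pXn2r ?nnegrE //; lra.
  rewrite (_ : _ `&` _ = set0).
    by rewrite /pr measure0 /= mulr_ge0 ?pr_ge0 // divr_ge0 ?sqr_ge0 // ltW.
  by apply/seteqP; split=> // w [/= ->]; rewrite leNgt ys.
rewrite (pr_cyl_split c); last exact: (@measurable_draws _ (fun t => share c t <= y)).
have h1 := IH (c :: s); have h0 := IH (~~ c :: s).
change (size (c :: s)) with (size s).+1 in h1.
change (size (~~ c :: s)) with (size s).+1 in h0.
rewrite !addSnnS in h1 h0.
apply: le_trans (lerD h1 h0) _ => {h1 h0}.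
have bF : (~~ c == c) = false by case: (c).
rewrite !pr_cyl_cons !share_cons // shareC // eqxx bF.
rewrite [X in _ <= (_ + X * _) / _ * _]big_ltn ?addnS ?ltnS ?leq_addr //.
move: (\sum_(_ <= _ < _) _) (sigma _ / _) => S a.
have S1 : 0 < share c s < 1 by rewrite share_gt0 // share_lt1.
set th := share c s in S1 *.
rewrite -subr_ge0; set D := ((x - y) ^+ 2)^-1.
(* One step adds the variance [a ^+ 2 * th * (1 - th)] to the square and keeps the mean [th] of the
   share; the allowance [a ^+ 2 * th] exceeds this by [(a * th) ^+ 2]. *)
rewrite (_ : _ - _ = (a * th) ^+ 2 * D * pr (cyl s)); last by rewrite /=; ring.
by rewrite mulr_ge0 ?pr_ge0 // mulr_ge0 ?sqr_ge0 // invr_ge0 ltW.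
Qed.

(** * Monopoly *)

Hypothesis sum_inv_tau : (\sum_(1 <= n <oo) ((tau n)^-1)%:E = +oo)%E.

Lemma measurable_constant_tail c N : measurable [set w | forall n, (N < n)%N -> I n w = c].
Proof.
rewrite (_ : [set _ | _] = \bigcap_(n in [set n | (N <= n)%N]) [set w | I n.+1 w = c]).
  by apply: bigcap_measurable => [|n _]; [exists N => /=|exact: measurable_draw].
apply/seteqP; split=> w h.
  by move=> n /= Nn; exact: h.
by case=> // n Nn; exact: h.
Qed.

(** A draw of the other colour after time [N] rules the event out, so [first_draw_le] applies with
    [eps = 0]. *)
Lemma constant_tail_null c N : P [set w | forall n, (N < n)%N -> I n w = c] = 0%E.
Proof.
have [s0 Tb _ _] := urn.
set E := [set w | _].
have mE : measurable E by exact: measurable_constant_tail.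
suff : pr E <= 0.
  move=> h; rewrite -EFin_pr //; congr EFin; apply/eqP.
  by rewrite eq_le h pr_ge0.
rewrite -[E]setTI -cyl_nil -(mul0r (pr (cyl [::]))).
apply: (@first_draw_le R sigma tau0 T0 s0 Tb (fun s => pr (cyl s))
  (fun s => pr (cyl s `&` E)) _ _ _ _ sum_inv_tau (~~ c) 0 N) => //.
- by move=> s; exact: pr_ge0.
- exact: pr_cyl_cons.
- by move=> c' s; exact: pr_cyl_split.
- move=> s; apply: le_pr; [|exact: measurable_cyl|exact: subIsetl].
  by apply: measurableI => //; exact: measurable_cyl.
move=> s Ns; rewrite mul0r (_ : _ `&` _ = set0) ?/pr ?measure0 //.
apply/seteqP; split=> // w []; rewrite cyl_cons => -[_ /= h] /(_ (size s).+1).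
by rewrite ltnS h => /(_ Ns); case: (c).
Qed.

Lemma monopoly_null : P (monopoly I) = 0%E.
Proof.
pose M c := \bigcup_N [set w | forall n, (N < n)%N -> I n w = c].
have H c : [set w | \forall n \near \oo, I n w = c] = M c.
  apply/seteqP; split=> w /=.
    by case=> N _ h; exists N => // n /ltnW; exact: h.
  by case=> N _ h; exists N.+1.
have mM c : measurable (M c).
  by apply: bigcup_measurable => N _; exact: measurable_constant_tail.
rewrite /monopoly !H; apply: measure_negligible; first exact: measurableU.
apply: negligibleU; apply: negligible_bigcup => N;
  (apply/negligibleP; [exact: measurable_constant_tail|exact: constant_tail_null]).
Qed.

(** * Domination *)

Variables (cl ch al be : R) (g : nat -> nat).
Hypotheses (cl_gt0 : 0 < cl) (ch_gt0 : 0 < ch) (al_gt0 : 0 < al) (be_gt0 : 0 < be).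
Hypothesis sigma_ge : forall n, (0 < n)%N -> tau n * cl <= n%:R * sigma n.
Hypothesis sigma_le : forall n, (0 < n)%N -> sigma n / tau n <= ch / n%:R.
Hypothesis g_gt0 : forall n, (0 < n)%N -> (0 < g n)%N.
Hypothesis sigma_al : forall n i, (0 < n)%N -> (n <= i <= n * g n)%N ->
  al * sigma n <= sigma i.
Hypothesis sigma_be : forall n i, (0 < n)%N -> (n <= i <= n * g n)%N ->
  sigma i <= be * sigma n.
Hypothesis g_infty : g n @[n --> \oo] --> \oo.

(** Chebyshev's inequality centred at the present share [x]: the squared steps sum to at most
    [ch ^ 2 / size s], so a variance of order [x / size s] is compared with [(x / 2) ^ 2]. *)
Lemma pr_share_halved c s k : (0 < size s)%N ->
  pr (cyl s `&` [set w | share c (draws (size s + k) w) <= share c s / 2]) <=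
  4 * ch ^+ 2 / ((size s)%:R * share c s) * pr (cyl s).
Proof.
have [s0 Tb _ _] := urn => ns.
set x := share c s; have x0 : 0 < x by exact: share_gt0.
have n0 : 0 < (size s)%:R :> R by rewrite ltr0n.
apply: le_trans (@pr_share_small c k s x (x / 2) _) _; first by lra.
apply: ler_wpM2r; first exact: pr_ge0.
rewrite -/x subrr expr0n /= add0r.
have -> : 4 * ch ^+ 2 / ((size s)%:R * x) =
    (ch ^+ 2 * (size s)%:R^-1 * x) / (x - x / 2) ^+ 2.
  by field; rewrite !gt_eqF //; lra.
rewrite ler_pM2r; last by rewrite invr_gt0 exprn_gt0 //; lra.
rewrite ler_pM2r //.
apply: le_trans (_ : ch ^+ 2 *
  \sum_(size s <= i < size s + k) (i.+1%:R^-1) ^+ 2 <= _); last first.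
  by rewrite ler_pM2l ?exprn_gt0 // sum_inv_sqr_le.
rewrite mulr_sumr; apply: ler_sum => i _.
rewrite -exprMn; have si := s0 i.+1 isT; have ti := tau_gt0 s0 Tb i.+1.
apply: lerXn2r; rewrite ?nnegrE; last exact: sigma_le.
  by rewrite ltW ?divr_gt0.
by rewrite ltW ?divr_gt0.
Qed.

Lemma share_limit_zero_null c (E : set Om) : measurable E ->
  (forall w, E w -> share c (draws n w) @[n --> \oo] --> 0) -> P E = 0%E.
Proof.
have [s0 Tb _ _] := urn => mE E0.
suff : pr E <= 0.
  move=> h; rewrite -EFin_pr //; congr EFin; apply/eqP.
  by rewrite eq_le h pr_ge0.
have mC t : measurable (cyl t `&` E).
  by apply: measurableI => //; exact: measurable_cyl.
rewrite -[E]setTI -cyl_nil.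
apply: (@harmonic_le0 R sigma tau0 T0 s0 Tb (fun s => pr (cyl s))
  (fun s => pr (cyl s `&` E)) _ _ _ _ sum_inv_tau cl al be g (4 * ch ^+ 2)
  cl_gt0 al_gt0 be_gt0 _ sigma_ge g_gt0 sigma_al sigma_be c _ g_infty) => //.
- by move=> s; exact: pr_ge0.
- exact: pr_cyl_cons.
- by move=> c' s; exact: pr_cyl_split.
- by move=> s; apply: le_pr; [|exact: measurable_cyl|exact: subIsetl].
- by rewrite mulr_gt0 ?exprn_gt0.
move=> s ns; set x := share c s; have x0 : 0 < x by exact: share_gt0.
rewrite -lee_fin EFin_pr //; set B := (_ * _ : R).
(* The events [A M] increase and cover the part of [E] in [cyl s], since the share tends to 0 there.
   Each lies in the event at the single time [size s + M], whose bound is free of [M]; continuity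
   from below concludes. *)
pose A M := cyl s `&` \bigcap_(m in [set m | (M <= m)%N])
  [set w | share c (draws (size s + m) w) <= x / 2].
have mS m : measurable [set w | share c (draws m w) <= x / 2].
  exact: (@measurable_draws _ (fun t => share c t <= x / 2)).
have mA M : measurable (A M).
  apply: measurableI; first exact: measurable_cyl.
  by apply: bigcap_measurable => [|n _]; [exists M => /=|exact: mS].
have mU : measurable (\bigcup_M A M) by exact: bigcup_measurable.
apply: (@le_trans _ _ (P (\bigcup_M A M))).
  rewrite le_measure ?inE // => w [ws /E0 wE].
  have [M _ hM] : \forall n \near \oo, share c (draws n w) < x / 2.
    by apply: (cvgr_lt _ wE); rewrite divr_gt0.
  exists M => //; split=> // m /= Mm.
  by apply/ltW/hM => /=; rewrite (leq_trans Mm) // leq_addl.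
have ndA : {homo A : n m / (n <= m)%N >-> (n <= m)%O}.
  move=> n m nm; apply/subsetPset => w [ws h]; split=> // j /= mj.
  by apply: h => /=; exact: leq_trans mj.
have cvgA := nondecreasing_cvg_mu (mu := P) mA mU ndA.
rewrite -(cvg_lim _ cvgA) //; apply: lime_le.
  by apply/cvg_ex; exists (P (\bigcup_M A M)).
near=> M; rewrite /= -EFin_pr // lee_fin.
apply: le_trans (pr_share_halved c M ns); apply: le_pr => //.
  by apply: measurableI; [exact: measurable_cyl|exact: mS].
by move=> w [ws h]; split=> //; apply: h => /=.
Unshelve. all: by end_near.
Qed.

(** Off a null set, [Theta = 0] makes the white share tend to 0, and [Theta = 1] the black share. *)
Lemma domination_null (Theta : {RV P >-> R}) :
  is_limit_prop sigma tau0 T0 I P Theta -> P (domination Theta) = 0%E.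
Proof.
have [s0 Tb _ _] := urn => -[N [mN N0 hN]].
have mT r : measurable [set w | Theta w = r].
  by have := measurable_funP Theta measurableT [set r]; rewrite setTI; apply.
have conv w : ~ N w -> white_prop sigma tau0 T0 I n w @[n --> \oo] --> Theta w.
  by move=> Nw; apply: contrapT => h; apply: Nw; exact: hN.
have null c (r : R) : (forall w, Theta w = r -> ~ N w ->
    share c (draws n w) @[n --> \oo] --> 0) -> P.-negligible [set w | Theta w = r].
  move=> h; apply: (@negligibleS _ _ _ _ (([set w | Theta w = r] `\` N) `|` N)).
    by move=> w wr; have [Nw|Nw] := pselect (N w); [right|left].
  apply: negligibleU; last by apply/negligibleP.
  have mD : measurable ([set w | Theta w = r] `\` N) by exact: measurableD.
  by apply/negligibleP => //; apply: (@share_limit_zero_null c) => // w [wr Nw]; exact: h.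
apply: measure_negligible; first exact: measurableU.
apply: negligibleU; [apply: (null true)|apply: (null false)] => w wr /conv; rewrite wr.
  by under eq_fun do rewrite white_prop_draws.
under eq_fun do rewrite white_prop_draws.
move=> h; rewrite -(subrr 1).
under eq_fun do rewrite -[false]/(~~ true) shareC //.
by apply: cvgB => //; exact: cvg_cst.
Qed.
End urn.

Theorem theorem1p2 (R : realType) (d : measure_display) (Om : measurableType d)
    (P : probability Om R) (sigma : nat -> R) (tau0 T0 : nat)
    (I : nat -> Om -> bool)
    (urn : is_polya_urn sigma tau0 T0 I P)
    (sum_inv_tau : (\sum_(1 <= n <oo) ((tau sigma tau0 n)^-1)%:E = +oo)%E) :
  P (monopoly I) = 0%E /\
  (asymp (fun n => sigma n / tau sigma tau0 n) (fun n => n%:R^-1) ->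
   (exists (g : nat -> nat) (alpha beta : R),
      [/\ forall n, (0 < n)%N -> (0 < g n)%N,
          g n @[n --> \oo] --> \oo,
          0 < alpha,
          0 < beta &
          forall n i, (0 < n)%N -> (n <= i <= n * g n)%N ->
            alpha < sigma i / sigma n < beta]) ->
   forall Theta : {RV P >-> R},
     is_limit_prop sigma tau0 T0 I P Theta ->
     P (domination Theta) = 0%E).
Proof.
have [s0 Tb _ _] := urn; split; first exact: monopoly_null urn sum_inv_tau.
move=> [cl [ch [cl0 ch0 hc]]] [g [al [be [g0 ginf al0 be0 hg]]]] Theta lim.
have hs n i : (0 < n)%N -> (n <= i <= n * g n)%N ->
    al * sigma n <= sigma i <= be * sigma n.
  move=> n0 /(hg _ _ n0); rewrite ltr_pdivlMr ?ltr_pdivrMr ?s0 //.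
  by case/andP => /ltW -> /ltW ->.
apply: (domination_null urn sum_inv_tau cl0 ch0 al0 be0 _ _ g0 _ _ ginf lim).
- move=> n n0; have /andP[+ _] := hc n n0.
  rewrite invrK mulrC mulrA ler_pdivlMr ?(tau_gt0 s0 Tb) // => h.
  by rewrite mulrC.
- move=> n n0; have /andP[_ +] := hc n n0.
  by rewrite invrK ler_pdivlMr ?ltr0n.
- by move=> n i n0 /(hs _ _ n0) /andP[].
- by move=> n i n0 /(hs _ _ n0) /andP[].
Qed.
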